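(* Let $k,m,n$ be positive integers with $k\neq m$, and suppose that $(k,n)=(2,1)$ or $(k,n)=(1,2)$. Then $$N_{k,m,n}(B)\gg B^5\log(2B).$$
   Context: For positive integers $k,m,n$ and a sufficiently large positive real number $B$, $N_{k,m,n}(B)$ denotes the number of integral solutions $(x_1,\ldots,x_5,y_1,\ldots,y_5)$ of the system $$\sum_{i=1}^5(x_i^k-y_i^k)=\sum_{i=1}^3(x_i^n-y_i^n)=\sum_{i=4}^5(x_i^m-y_i^m)=0$$ with $1\le x_i,y_i\le B$ $(1\le i\le 5)$. The notation $X\gg Y$ means that $X\ge cY$ for all sufficiently large $B$, where $c>0$ may depend on $k,m,n$. *)

(* Defs.v *)
From mathcomp Require Import all_boot all_order all_algebra.
From mathcomp Require Import finmap.
From mathcomp Require Import all_classical all_reals all_analysis.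

Set Implicit Arguments.
Unset Strict Implicit.
Unset Printing Implicit Defensive.

Import Order.TTheory GRing.Theory Num.Theory.
Import numFieldNormedType.Exports.

Local Open Scope classical_set_scope.
Local Open Scope ring_scope.

(* The variables x_1, ..., x_5 are indexed from 0: x_(i+1) is [x i] for
   [i : 'I_5], so that the ranges 1 <= i <= 3 and 4 <= i <= 5 of the system
   become [i < 3] and [3 <= i]. *)
Definition is_solution (R : realType) (k m n : nat) (B : R)
    (x y : {ffun 'I_5 -> int}) : Prop :=
  [/\ \sum_(i < 5) (x i ^+ k - y i ^+ k) = 0,
      \sum_(i < 5 | (i < 3)%N) (x i ^+ n - y i ^+ n) = 0,
      \sum_(i < 5 | (3 <= i)%N) (x i ^+ m - y i ^+ m) = 0,
      forall i, 1 <= x i /\ (x i)%:~R <= B &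
      forall i, 1 <= y i /\ (y i)%:~R <= B].

Definition solutions (R : realType) (k m n : nat) (B : R) :
    set ({ffun 'I_5 -> int} * {ffun 'I_5 -> int}) :=
  [set xy | is_solution k m n B xy.1 xy.2].

(* [fset_set] returns the empty set on infinite sets; the next lemma shows that
   this default is never used in [nb_solutions]. *)
Lemma finite_solutions (R : realType) (k m n : nat) (B : R) :
  finite_set (solutions k m n B).
Proof.
pose T := 'I_(`|Num.floor B|%N).+1.
pose emb (f : {ffun 'I_5 -> T}) : {ffun 'I_5 -> int} := [ffun i => Posz (f i)].
pose F (fg : {ffun 'I_5 -> T} * {ffun 'I_5 -> T}) := (emb fg.1, emb fg.2).
have surj (x : {ffun 'I_5 -> int}) :
    (forall i, 1 <= x i /\ (x i)%:~R <= B) -> exists f, emb f = x.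
  move=> xB; exists [ffun i => inord `|x i|%N]; apply/ffunP => i.
  have [x1 xleB] := xB i.
  have xf : x i <= Num.floor B by rewrite floor_ge_int.
  have x0 : 0 <= x i by rewrite (le_trans _ x1).
  rewrite !ffunE inordK ?gez0_abs// ltnS -lez_nat !gez0_abs//.
  exact: le_trans xf.
apply: (@sub_finite_set _ _ (F @` setT)); last exact/finite_image/finite_finset.
move=> [x y] [_ _ _ /surj[f fx] /surj[g gy]].
by exists (f, g) => //; rewrite /F /= fx gy.
Qed.

Definition nb_solutions (R : realType) (k m n : nat) (B : R) : nat :=
  #|` fset_set (solutions k m n B)|%fset.

(* Main.v *)
Require Import Defs.
From mathcomp Require Import all_boot all_order all_algebra.
From mathcomp Require Import finmap cyclic.
From mathcomp Require Import all_classical all_reals all_analysis.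
From mathcomp Require Import zify ring lra.

Import Order.TTheory GRing.Theory Num.Theory.
Import numFieldNormedType.Exports.

Local Open Scope classical_set_scope.
Local Open Scope ring_scope.

(** Solutions with x4 = y4 and x5 = y5 suffice, whatever m is. For the other
    three pairs, writing x_i = s_i + h_i and y_i = s_i - h_i turns equality of
    the sums and of the sums of squares into p u = q v, where p = h_1, q = h_2,
    u = s_1 - s_3 and v = s_3 - s_2, while t = s_3 is free. Taking p = c d,
    q = a d, v = c e and u = a e with a < c coprime and d, e <= M / c, where
    M is about B / 5, gives M^3 * sum_(c <= M) phi(c) (M / c)^2 solutions.
    The logarithm comes from n = sum_(d | n) phi(d): dividing by n^2 and summing
    over n <= M bounds the harmonic sum by 2 sum_(d <= M) phi(d) / d^2. *)

(** Induction on [M]: the quotient [M %/ d] grows by one exactly when [d] divides [M.+1]. *)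
Lemma sum_multiples (V : nmodType) (f : nat -> V) (d M : nat) : (0 < d)%N ->
  \sum_(1 <= n < M.+1 | (d %| n)%N) f n =
  \sum_(1 <= k < (M %/ d).+1) f (d * k)%N.
Proof.
move=> d_gt0; elim: M => [|M IHM]; first by rewrite div0n !big_geq.
rewrite big_mkcond big_nat_recr//= -big_mkcond IHM divnS//=.
case: ifP => dM; last by rewrite add0n addr0.
rewrite add1n [RHS]big_nat_recr//=; congr (_ + f _).
by rewrite -{1}(divnK dM) divnS// dM add1n mulnC.
Qed.

Lemma sum_inv_sqr_le2 (R : realFieldType) (q : nat) :
  \sum_(1 <= k < q.+1) (k%:R ^+ 2)^-1 <= 2 :> R.
Proof.
(* The sharper bound makes the induction go through. At [q = 0] the inverse is 0 by convention, too
   weak to yield [q = 1], which is checked separately. *)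
suff: \sum_(1 <= k < q.+1) (k%:R ^+ 2)^-1 <= 2 - q%:R^-1 :> R.
  by move/le_trans; apply; rewrite gerBl invr_ge0.
elim: q => [|[_|q IHq]]; first by rewrite big_geq// invr0 subr0.
  by rewrite big_nat1 expr1n invr1; lra.
rewrite big_nat_recr//= (le_trans (lerD IHq (lexx _)))//.
rewrite -subr_ge0.
have q0 : 0 <= q%:R :> R by [].
have -> : 2 - q.+2%:R^-1 - (2 - q.+1%:R^-1 + (q.+2%:R ^+ 2)^-1) =
    (q.+1%:R * q.+2%:R ^+ 2)^-1 :> R.
  by rewrite -[q.+2]addn2 -[q.+1]addn1 !natrD; field; apply/andP; split; lra.
by rewrite invr_ge0 mulr_ge0// exprn_ge0.
Qed.

Lemma harmonic_sum_le_sum_totient (R : realFieldType) (M : nat) :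
  \sum_(1 <= n < M.+1) n%:R^-1 <=
  2 * \sum_(1 <= d < M.+1) (totient d)%:R / d%:R ^+ 2 :> R.
Proof.
rewrite [leLHS](_ : _ = \sum_(1 <= n < M.+1)
    \sum_(1 <= d < M.+1 | (d %| n)%N) (totient d)%:R / n%:R ^+ 2); last first.
  apply: eq_big_nat => n /andP[n_gt0 nM].
  rewrite -mulr_suml -natr_sum.
  have -> : (\sum_(1 <= d < M.+1 | d %| n) totient d)%N = n.
    rewrite -[RHS]sum_totient_dvd.
    (* The classical identity sums over 0 <= d <= n; neither d = 0 nor any d > n divides the
       positive [n]. *)
    rewrite -(big_mkord (fun d => d %| n)%N totient).
    rewrite [RHS]big_mkcond big_ltn//= dvd0n gtn_eqF// add0n -big_mkcond/=.
    rewrite (big_cat_nat (n := n.+1))//= [X in (_ + X)%N]big_nat_cond.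
    rewrite [X in (_ + X)%N]big_pred0 ?addn0// => d.
    by apply/negP => /andP[/andP[nd _] /dvdn_leq]; lia.
  by rewrite expr2 invfM mulrA divff ?mul1r// pnatr_eq0; lia.
(* For fixed [d], writing n = d k leaves phi(d) / d^2 times a sum of 1 / k^2. *)
rewrite (exchange_big_dep xpredT)//= mulr_sumr.
rewrite big_nat [leRHS]big_nat; apply: ler_sum => d /andP[d_gt0 _].
rewrite sum_multiples//.
under eq_bigr do rewrite natrM exprMn invfM mulrA.
by rewrite -mulr_sumr mulrC ler_wpM2r ?sum_inv_sqr_le2// divr_ge0// exprn_ge0.
Qed.

(** Each step increases the logarithm by ln (1 + 1 / (M + 1)) <= 1 / (M + 1). *)
Lemma ln_le_harmonic_sum (R : realType) (M : nat) :
  ln M.+1%:R <= \sum_(1 <= n < M.+1) n%:R^-1 :> R.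
Proof.
elim: M => [|M IHM]; first by rewrite big_geq// ln1.
rewrite big_nat_recr//= (le_trans _ (lerD IHM (lexx _)))//.
have -> : M.+2%:R = M.+1%:R * (1 + M.+1%:R^-1) :> R.
  by rewrite mulrDr mulr1 divff// natr1.
have M0 : 0 < M.+1%:R^-1 :> R by rewrite invr_gt0.
have M1 : 0 < 1 + M.+1%:R^-1 :> R by rewrite addr_gt0.
rewrite lnM ?posrE// lerD2l le_ln1Dx//.
by rewrite (lt_trans _ M0)// ltrN10.
Qed.

Lemma ln_le_sum_totient_divn (R : realType) (M : nat) :
  M%:R ^+ 2 * ln M.+1%:R <=
  8 * (\sum_(c < M) totient c.+1 * (M %/ c.+1) ^ 2)%:R :> R.
Proof.
have := le_trans (ln_le_harmonic_sum R M) (harmonic_sum_le_sum_totient R M).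
move=> /(ler_wpM2l (exprn_ge0 2 (ler0n R M)))/le_trans; apply.
rewrite big_add1 big_mkord natr_sum !mulr_sumr; apply: ler_sum => c _.
(* Since [c.+1 <= M], the integer part is at least half the quotient. Squaring costs a factor 4,
   whence 8 = 2 * 4. *)
have hM : M%:R <= c.+1%:R * (2 * (M %/ c.+1)%:R) :> R.
  rewrite -!natrM ler_nat.
  have := divn_eq M c.+1; have := ltn_pmod M (ltn0Sn c).
  by have := divn_gt0 M (ltn0Sn c); have := ltn_ord c; nia.
have {hM} : (M%:R / c.+1%:R) ^+ 2 <= (2 * (M %/ c.+1)%:R) ^+ 2 :> R.
  by rewrite lerXn2r ?nnegrE ?divr_ge0 ?mulr_ge0// ler_pdivrMr// mulrC.
move=> /(ler_wpM2l (ler0n R (2 * totient c.+1))).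
rewrite -mulnn !natrM expr_div_n exprMn.
move: (c.+1%:R ^+ 2)^-1 (totient c.+1)%:R => x y; lra.
Qed.

(** A fraction a / c in lowest terms determines its denominator, as [c] and [c'] divide each
    other. *)
Lemma coprime_cross_eq (a c a' c' : nat) :
  coprime c a -> coprime c' a' -> (a * c' = a' * c)%N -> c = c'.
Proof.
move=> ca ca' acE; apply/eqP; rewrite eqn_dvd.
rewrite -(Gauss_dvdr c' ca) acE dvdn_mull//=.
by rewrite -(Gauss_dvdr c ca') -acE dvdn_mull.
Qed.

Definition ffun5 (s : seq int) : {ffun 'I_5 -> int} := [ffun i : 'I_5 => s`_i].

Lemma ffun5_inj (s s' : seq int) :
  size s = 5%N -> size s' = 5%N -> ffun5 s = ffun5 s' -> s = s'.
Proof.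
move=> s5 s'5 /ffunP ss'; apply: (@eq_from_nth _ 0); first by rewrite s5.
by rewrite s5 => i i5; have := ss' (Ordinal i5); rewrite !ffunE.
Qed.

(** The two triples have identical sums, and their sums of squares differ by 4 (p u - q v). *)
Lemma is_solution_ffun5 (R : realType) (k m n : nat) (B : R)
    (p q u v t w z : int) :
  (k = 2 /\ n = 1 \/ k = 1 /\ n = 2)%N -> p * u = q * v ->
  let s := [:: t + u + p; t - v + q; t - p - q; w; z] in
  let s' := [:: t + u - p; t - v - q; t + p + q; w; z] in
  {in s ++ s', forall a, 1 <= a /\ a%:~R <= B} ->
  is_solution k m n B (ffun5 s) (ffun5 s').
Proof.
move=> kn puqv s s' sB.
split; try by move=> i; rewrite ffunE; apply: sB; rewrite mem_cat mem_nth ?orbT.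
- rewrite !big_ord_recr big_ord0 /= !ffunE /=.
  case: kn => -[? ?]; subst; last by ring.
  by transitivity (4 * (p * u - q * v)); [ring|rewrite puqv subrr mulr0].
- rewrite big_mkcond !big_ord_recr big_ord0 /= !ffunE /=.
  case: kn => -[? ?]; subst; first by ring.
  by transitivity (4 * (p * u - q * v)); [ring|rewrite puqv subrr mulr0].
- rewrite big_mkcond !big_ord_recr big_ord0 /= !ffunE /=; ring.
Qed.

(** A dependent sum, because the ranges of [a], [d] and [e] depend on [c]; the last three factors
    hold [t], [w] and [z]. *)
Definition family_params (M : nat) : finType :=
  ({c : 'I_M &
      {a : 'I_c.+1 | coprime c.+1 a} * 'I_(M %/ c.+1) * 'I_(M %/ c.+1)}
  * 'I_M * 'I_M * 'I_M)%type.

Lemma card_family_params (M : nat) :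
  #|family_params M| = (M ^ 3 * \sum_(c < M) totient c.+1 * (M %/ c.+1) ^ 2)%N.
Proof.
rewrite !card_prod card_tagged !card_ord sumnE big_map big_enum/=.
rewrite [RHS]mulnC !expnS expn0 muln1 -!mulnA; congr (_ * _)%N.
apply: eq_bigr => c _; rewrite !card_prod !card_ord -mulnA -mulnn.
congr (_ * _)%N.
rewrite card_sub totient_count_coprime big_mkord -sum1_card big_mkcond.
by apply: eq_bigr => a _; rewrite inE; case: coprime.
Qed.

(* The ordinals being indexed from 0, c, d, e, w and z are shifted by 1; t
   ranges over ]2M, 3M], which keeps all coordinates in [1, 5M]. *)
Definition family_sols (M : nat) (s : family_params M) :
    {ffun 'I_5 -> int} * {ffun 'I_5 -> int} :=
  let: (existT c (a, d, e), t, w, z) := s in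
  let c := Posz c.+1 in let a := Posz (val (val a)) in
  let d := Posz d.+1 in let e := Posz e.+1 in let t := Posz (M + M + t.+1) in
  let w := Posz w.+1 in let z := Posz z.+1 in
  (ffun5 [:: t + a * e + c * d; t - c * e + a * d; t - c * d - a * d; w; z],
   ffun5 [:: t + a * e - c * d; t - c * e - a * d; t + c * d + a * d; w; z]).

(** Sums and differences of paired coordinates give t, c d, a d and c e. The reduced fraction a / c
    = (a d) / (c d) then fixes c, and division gives the rest. *)
Lemma family_sols_inj (M : nat) : injective (family_sols M).
Proof.
move=> [[[[c [[[a ca] d] e]] t] w] z] [[[[c' [[[a' ca'] d'] e']] t'] w'] z'].
rewrite /family_sols => -[/ffun5_inj-/(_ erefl erefl) E].
move=> /ffun5_inj-/(_ erefl erefl) E'.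
case: E => E0 E1 E2 E3 E4; case: E' => E0' E1' E2' _ _.
have tE : t = t' by apply: val_inj => /=; lia.
have wE : w = w' by apply: val_inj => /=; lia.
have zE : z = z' by apply: val_inj => /=; lia.
subst t' w' z'.
have cd : (c.+1 * d.+1 = c'.+1 * d'.+1)%N by lia.
have ad : (a * d.+1 = a' * d'.+1)%N by lia.
have ce : (c.+1 * e.+1 = c'.+1 * e'.+1)%N by lia.
have cc : c.+1 = c'.+1.
  apply: (coprime_cross_eq _ _ _ _ ca ca').
  apply/eqP; rewrite -(eqn_pmul2r (ltn0Sn d')) -(eqn_pmul2l (ltn0Sn d)).
  by apply/eqP; nia.
have {}cc : c = c' by apply: val_inj; case: cc.
subst c'.
have dE : d = d' by apply: val_inj => /=; nia.
have eE : e = e' by apply: val_inj => /=; nia.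
subst d' e'.
have aE : a = a' by apply: val_inj => /=; nia.
by subst a'; rewrite (bool_irrelevance ca ca').
Qed.

Lemma card_family_params_le_nb_solutions (R : realType) (k m n M : nat)
    (B : R) :
  (k = 2 /\ n = 1 \/ k = 1 /\ n = 2)%N -> 5 * M%:R <= B ->
  (#|family_params M| <= nb_solutions k m n B)%N.
Proof.
move=> kn MB.
have <- : #|` [fset family_sols M s | s in {: family_params M}]%fset| =
    #|family_params M|.
  by rewrite card_imfset ?cardE//=; exact: family_sols_inj.
apply: fsubset_leq_card; apply/fsubsetP => _ /imfsetP[s _ ->].
rewrite in_fset_set; last exact: finite_solutions.
rewrite inE; case: s => [[[[c [[[a ca] d] e]] t] w] z] /=.
have le5M (x : int) : x <= 5 * M%:Z -> x%:~R <= B.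
  by rewrite -(ler_int R) intrM => /le_trans; apply.
apply: is_solution_ffun5 => //.
  by ring.
have cM := ltn_ord c.
(* All four products are at most [M], so the first three coordinates on each side stay within 2 M of
   the shifted t. *)
have [cdM ceM] : (c.+1 * d.+1 <= M)%N /\ (c.+1 * e.+1 <= M)%N.
  by rewrite ![(c.+1 * _)%N]mulnC -!leq_divRL.
have [adM aeM] : (a * d.+1 <= M)%N /\ (a * e.+1 <= M)%N.
  by have := ltn_ord a; nia.
have tM := ltn_ord t; have wM := ltn_ord w; have zM := ltn_ord z.
move=> x; rewrite mem_cat !inE => xE.
suff: 1 <= x <= 5 * M%:Z by case/andP => x1 /le5M.
move: xE; rewrite -!orbA.
by do ?[case/orP => [/eqP->|]]; try move/eqP->; apply/andP; split; lia.
Qed.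

(** The threshold 50 gives 2 B <= B^2 / 25 <= (M + 1)^2, hence a factor 2 in the logarithm; also B
    <= 10 M. The 16 is this 2 times the 8 of [ln_le_sum_totient_divn]. *)
Lemma quintic_log_le (R : realType) (B : R) (M : nat) : 50 <= B ->
  M%:R <= B / 5 < M.+1%:R ->
  (16 * 10 ^+ 5)^-1 * (B ^+ 5 * ln (2 * B)) <= M%:R ^+ 5 * ln M.+1%:R / 8.
Proof.
move=> B50 /andP[MB BM].
have B0 : 0 < B by lra.
have lnB : ln (2 * B) <= 2 * ln M.+1%:R.
  rewrite [leRHS]mulr_natl -lnXn// ler_ln ?posrE ?exprn_gt0 ?mulr_gt0//.
  by nra.
have BM10 : B <= 10 * M%:R.
  by move: BM; rewrite -(natr1 M); lra.
have B5 : B ^+ 5 <= 10 ^+ 5 * M%:R ^+ 5.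
  by rewrite -exprMn lerXn2r ?nnegrE ?mulr_ge0// ltW.
have ln0 : 0 <= ln (2 * B) by rewrite ln_ge0//; lra.
have := ler_pM (exprn_ge0 5 (ltW B0)) ln0 B5 lnB.
lra.
Qed.

Theorem mainTheorem2 (R : realType) (k m n : nat)
    (k_gt0 : (0 < k)%N) (m_gt0 : (0 < m)%N) (n_gt0 : (0 < n)%N)
    (k_neq_m : k <> m)
    (kn : (k = 2%N /\ n = 1%N) \/ (k = 1%N /\ n = 2%N)) :
  exists2 c : R, 0 < c &
    \forall B \near +oo, c * (B ^+ 5 * ln (2 * B)) <= (nb_solutions k m n B)%:R.
Proof.
exists (16 * 10 ^+ 5)^-1; first by rewrite invr_gt0 mulr_gt0// exprn_gt0.
near=> B.
have B50 : 50 <= B by near: B; exact: nbhs_pinfty_ge.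
(* M is the integer part of B / 5, the largest value keeping the bound 5 M on the coordinates below
   B. *)
have hM : (Num.truncn (B / 5))%:R <= B / 5 < (Num.truncn (B / 5)).+1%:R.
  by apply: truncn_itv; lra.
apply: le_trans (quintic_log_le _ _ _ B50 hM) _.
move: (Num.truncn _) hM => M /andP[MB _].
have MB5 : 5 * M%:R <= B by lra.
have := @card_family_params_le_nb_solutions R k m n M B kn MB5.
rewrite -(ler_nat R) => /(le_trans _); apply.
rewrite card_family_params natrM natrX.
have := ler_wpM2l (exprn_ge0 3 (ler0n R M)) (ln_le_sum_totient_divn R M).
lra.
Unshelve. all: by end_near.
Qed.
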